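(* Let $G$ be the collection of all finite intersections $W_1\cap\cdots\cap W_q$ of toric subspaces of the $n$-dimensional torus $T^n$, and let $L$ be the distributive lattice of subsets of $T^n$ obtained from $G$ by finite intersections, finite unions and complements. Then there is a valuation $v$ on $L$ with values in the polynomial ring $\mathbb{Z}[t]$ such that $v(V)=t^k$ for every $k$-dimensional toric subspace $V$.
   Context: $T^n=\mathbb{R}^n/\mathbb{Z}^n$. A toric subspace of $T^n$ is the image under the quotient map $\mathbb{R}^n\to\mathbb{R}^n/\mathbb{Z}^n$ of an affine subspace $\{\vec v\in\mathbb{R}^n: A\vec v=\vec b\}$ where $A$ has rational entries and $\vec b$ is real; if the affine subspace has dimension $k$, the toric subspace is a $k$-dimensional torus and is said to have dimension $k$. A valuation on $L$ with values in an abelian group is a function $v$ with $v(\emptyset)=0$ and $v(A)+v(B)=v(A\cap B)+v(A\cup B)$ for all $A,B\in L$. *)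

(* Defs.v *)
From HB Require Import structures.
From mathcomp Require Import all_boot all_order all_algebra.
From mathcomp Require Import generic_quotient.
From mathcomp Require Import classical_sets reals measurable_structure.

Set Implicit Arguments.
Unset Strict Implicit.
Unset Printing Implicit Defensive.

Import GRing.Theory.

Local Open Scope classical_set_scope.
Local Open Scope quotient_scope.
Local Open Scope ring_scope.

Definition eq_mod_int (R : realType) (n : nat) : rel 'cV[R]_n :=
  fun x y => x - y \is a mxOver Num.int.

Lemma eq_mod_int_refl (R : realType) (n : nat) : reflexive (@eq_mod_int R n).
Proof. by move=> x; apply/mxOverP => i j; rewrite subrr mxE rpred0. Qed.

Lemma eq_mod_int_sym (R : realType) (n : nat) : symmetric (@eq_mod_int R n).
Proof.
suff imp x y : @eq_mod_int R n x y -> eq_mod_int y x.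
  by move=> x y; apply/idP/idP; apply: imp.
move=> /mxOverP xy; apply/mxOverP => i j.
by rewrite -opprB mxE rpredN.
Qed.

Lemma eq_mod_int_trans (R : realType) (n : nat) : transitive (@eq_mod_int R n).
Proof.
move=> y x z /mxOverP xy /mxOverP yz; apply/mxOverP => i j.
by rewrite -(subrKA y) mxE rpredD.
Qed.

Canonical eq_mod_int_equiv (R : realType) (n : nat) :=
  EquivRel (@eq_mod_int R n) (@eq_mod_int_refl R n) (@eq_mod_int_sym R n)
    (@eq_mod_int_trans R n).

Definition torus (R : realType) (n : nat) : Type :=
  {eq_quot (@eq_mod_int R n)}.

Definition torus_proj (R : realType) (n : nat) (x : 'cV[R]_n) : torus R n :=
  \pi_({eq_quot (@eq_mod_int R n)}) x.

Definition affine_subspace (R : realType) (m n : nat)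
    (A : 'M[rat]_(m, n)) (b : 'cV[R]_m) : set 'cV[R]_n :=
  [set x | map_mx ratr A *m x = b].

(* The space of directions { x in R^n | A x = 0 } of [affine_subspace A b]. *)
Definition direction (R : realType) (m n : nat) (A : 'M[rat]_(m, n)) :
    {vspace 'cV[R]_n} :=
  lker (linfun (mulmx (map_mx ratr A) : 'cV[R]_n -> 'cV[R]_m)).

(* Inconsistent systems A x = b are excluded: an affine subspace is nonempty,
   and its dimension is that of its space of directions. *)
Definition toric_subspace_of_dim (R : realType) (n k : nat)
    (V : set (torus R n)) : Prop :=
  exists (m : nat) (A : 'M[rat]_(m, n)) (b : 'cV[R]_m),
    [/\ affine_subspace A b !=set0,
        \dim (direction R A) = k
      & V = @torus_proj R n @` affine_subspace A b].

Definition toric_subspace (R : realType) (n : nat) (V : set (torus R n)) :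
    Prop :=
  exists k : nat, toric_subspace_of_dim k V.

Definition toric_intersections (R : realType) (n : nat) :
    set (set (torus R n)) :=
  [set V | exists (q : nat) (W : 'I_q.+1 -> set (torus R n)),
    (forall i, toric_subspace (W i)) /\ V = \bigcap_(i in setT) W i].

Definition toric_lattice (R : realType) (n : nat) : set (set (torus R n)) :=
  smallest
    [set M | [/\ setI_closed M, setU_closed M & setC_closed M]]
    (@toric_intersections R n).

(* [v] is a total function, but only its values on members of [L] matter. *)
Definition is_valuation (T : Type) (V : zmodType) (L : set (set T))
    (v : set T -> V) : Prop :=
  v set0 = 0 /\
  forall A B : set T, L A -> L B -> v A + v B = v (A `&` B) + v (A `|` B).

(* Main.v *)
(* The indicator functions of toric subspaces are linearly independent: if a
   finite combination of them vanishes, evaluate it at a point of a toric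
   subspace of maximal dimension that lies on no other one. Hence V |-> t^dim V
   extends linearly to their Z-span. The intersection of two toric subspaces is a
   finite disjoint union of toric subspaces, so the span is closed under products
   and contains the indicator functions of all members of the lattice; the
   valuation property is additivity applied to 1_A + 1_B = 1_(A/\B) + 1_(A\/B). *)
Require Import Defs.
From HB Require Import structures.
From mathcomp Require Import all_boot all_order all_algebra generic_quotient.
From mathcomp Require Import boolp classical_sets reals measurable_structure.
From mathcomp Require Import ring.

Set Implicit Arguments.
Unset Strict Implicit.
Unset Printing Implicit Defensive.

Import Order.TTheory GRing.Theory Num.Theory.

Local Open Scope ring_scope.

(** * Avoiding integers and hyperplanes *)

(** An affine function of nonzero slope takes integral values only at a discrete set of parameters,
    so the interval can be shrunk towards [a] once for each pair. *)
Lemma interval_avoid_int (R : realType) (l : seq (R * R)) (a b : R) : a < b ->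
  exists2 s, a < s < b &
    forall p, p \in l -> p.1 != 0 -> p.1 * s + p.2 \isn't a Num.int.
Proof.
elim: l a b => [|[c e] l IH] a b ab.
  by have [h1 h2] := midf_lt ab; exists ((a + b) / 2); rewrite ?h1.
suff [b' /andP[ab' b'b] hb'] : exists2 b', a < b' <= b &
    forall s, a < s < b' -> c != 0 -> c * s + e \isn't a Num.int.
  have [s /andP[as_ sb'] hs] := IH a b' ab'.
  exists s; first by rewrite as_ (lt_le_trans sb').
  move=> p; rewrite inE => /predU1P[->|/hs//]; apply: hb'.
  by rewrite as_ sb'.
wlog c_gt0 : c e / 0 < c => [hwlog|].
  have [/hwlog//|c_le0] := ltrP 0 c.
  have [->|c0] := eqVneq c 0; first by exists b; rewrite ?ab /=.
  have [|b' ? hb'] := hwlog (- c) (- e).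
    by rewrite oppr_gt0 lt_def eq_sym c0.
  exists b' => // s /hb'; rewrite oppr_eq0 => /(_ c0) h _.
  by rewrite mulNr -opprD rpredN in h.
(* Between [a] and the parameter where [c * s + e] reaches [k + 1], its value lies strictly between
   [k] and [k + 1]. *)
set k := Num.floor (c * a + e).
have ka : k%:~R <= c * a + e by exact: floor_le.
have ak : c * a + e < (k + 1)%:~R by exact: floorD1_gt.
exists (Num.min b (((k + 1)%:~R - e) / c)).
  by rewrite lt_min ab ltr_pdivlMr //= ltrBrDr mulrC ak ge_min lexx.
move=> s /andP[as_]; rewrite lt_min ltr_pdivlMr // ltrBrDr mulrC.
move=> /andP[_ sk] _.
apply/negP => /intrP[m hm]; move: sk; rewrite hm ltr_int.
have : k%:~R < (m%:~R : R).
  by rewrite -hm (le_lt_trans ka) // ltrD2r ltr_pM2l.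
by rewrite ltr_int -lezD1 => ? /lt_geF /negP; apply.
Qed.

(** A real vector space is not a finite union of proper subspaces: to a vector good for [l] is added
    a multiple of one good for [f], chosen so that no value that varies with it is an integer, let
    alone zero. *)
Lemma exists_direction (R : realType) (n : nat) (K : {vspace 'cV[R]_n})
    (l : seq 'rV[R]_n) :
  (forall f, f \in l -> exists2 x, x \in K & (f *m x) 0 0 != 0) ->
  exists2 d, d \in K & forall f, f \in l -> (f *m d) 0 0 != 0.
Proof.
elim: l => [|f l IH] hl; first by exists 0; rewrite ?mem0v.
have [d dK hd] := IH (fun g gl => hl g (mem_behead (s := f :: l) gl)).
have [x xK fx] := hl f (mem_head _ _).
have [s _ hs] := @interval_avoid_int R
  [seq ((g *m x) 0 0, (g *m d) 0 0) | g <- f :: l] 0 1 ltr01.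
exists (s *: x + d); first by rewrite memvD ?memvZ.
move=> g gl; rewrite mulmxDr -scalemxAr mxE [X in X + _]mxE mulrC.
have [gx0|gx0] := eqVneq ((g *m x) 0 0) 0.
  rewrite gx0 mul0r add0r hd //; move: gl; rewrite inE => /predU1P[gf|//].
  by rewrite -gf gx0 eqxx in fx.
have /hs/(_ gx0)/= : ((g *m x) 0 0, (g *m d) 0 0)
  \in [seq ((g *m x) 0 0, (g *m d) 0 0) | g <- f :: l] by exact: map_f.
by apply: contraNneq => ->; rewrite rpred0.
Qed.

(** * Denominators and integral matrices *)

Lemma common_denominator (m n : nat) (A : 'M[rat]_(m, n)) :
  exists2 N : nat, (0 < N)%N & A *+ N \is a mxOver Num.int.
Proof.
pose d (ij : 'I_m * 'I_n) := `|denq (A ij.1 ij.2)|%N.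
exists (\prod_ij d ij)%N; first by rewrite prodn_gt0 // => ij; rewrite absz_gt0.
apply/mxOverP => i j; rewrite mulmxnE (bigD1 (i, j)) //= mulrnA rpredMn //.
by rewrite -mulr_natr natr_absz ger0_norm // -numqE rpred_int.
Qed.

Section IntegralMatrices.
Variable R : archiRealDomainType.

(* [rpredN] and [rpredD] do not see through [mxOver Num.int]. *)
Lemma int_mxN (m n : nat) (A : 'M[R]_(m, n)) :
  (- A \is a mxOver Num.int) = (A \is a mxOver Num.int).
Proof.
by apply/mxOverP/mxOverP => h i j; move: (h i j); rewrite mxE rpredN.
Qed.

Lemma int_mxD (m n : nat) (A B : 'M[R]_(m, n)) :
  A \is a mxOver Num.int -> B \is a mxOver Num.int ->
  A + B \is a mxOver Num.int.
Proof.
by move=> /mxOverP hA /mxOverP hB; apply/mxOverP => i j; rewrite mxE rpredD.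
Qed.

Lemma int_mxB (m n : nat) (A B : 'M[R]_(m, n)) :
  A \is a mxOver Num.int -> B \is a mxOver Num.int ->
  A - B \is a mxOver Num.int.
Proof. by move=> hA hB; rewrite int_mxD ?int_mxN. Qed.

Lemma int_mxM (m n p : nat) (A : 'M[R]_(m, n)) (B : 'M[R]_(n, p)) :
  A \is a mxOver Num.int -> B \is a mxOver Num.int ->
  A *m B \is a mxOver Num.int.
Proof.
move=> /mxOverP hA /mxOverP hB; apply/mxOverP => i j; rewrite mxE.
by apply: rpred_sum => k _; rewrite rpredM.
Qed.

End IntegralMatrices.

(** * Toric subspaces given by equations and a base point *)

Lemma torus_proj_eq (R : realType) (n : nat) (x y : 'cV[R]_n) :
  torus_proj x = torus_proj y <-> x - y \is a mxOver Num.int.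
Proof. exact: rwP (@eqmodP _ (eq_mod_int_equiv R n) x y). Qed.

Lemma torus_proj_surj (R : realType) (n : nat) (y : torus R n) :
  exists x, y = torus_proj x.
Proof. by exists (repr y); rewrite /torus_proj reprK. Qed.

Lemma mem_direction (R : realType) (m n : nat) (A : 'M[rat]_(m, n))
    (x : 'cV[R]_n) :
  (x \in direction R A) = (map_mx ratr A *m x == 0).
Proof. by rewrite memv_ker lfunE. Qed.

(** A base point replaces the right-hand side, so the system is consistent by construction. *)
Record toric_datum (R : realType) (n : nat) := ToricDatum {
  datum_rows : nat;
  datum_mx : 'M[rat]_(datum_rows, n);
  datum_pt : 'cV[R]_n }.

HB.instance Definition _ (R : realType) (n : nat) :=
  gen_eqMixin (toric_datum R n).
HB.instance Definition _ (R : realType) (n : nat) :=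
  gen_choiceMixin (toric_datum R n).

Section ToricData.
Variables (R : realType) (n : nat).
Implicit Types (t u : toric_datum R n) (x y : 'cV[R]_n).

Definition datum_dir t : {vspace 'cV[R]_n} := direction R (datum_mx t).

Definition datum_set t : set (torus R n) :=
  @torus_proj R n @` [set x | x - datum_pt t \in datum_dir t].

Lemma datum_setP t x : datum_set t (torus_proj x) <->
  exists2 z, z \is a mxOver Num.int & x - z - datum_pt t \in datum_dir t.
Proof.
split=> [[y yt /torus_proj_eq yx]|[z zint xt]].
  by exists (x - y); rewrite ?subKr // -opprB int_mxN.
by exists (x - z) => //; apply/torus_proj_eq; rewrite -opprB int_mxN subKr.
Qed.

Lemma toric_subspace_of_dimP (k : nat) (V : set (torus R n)) :
  toric_subspace_of_dim k V <->
  exists2 t, V = datum_set t & \dim (datum_dir t) = k.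
Proof.
split=> [[m [A [b [[x0 x0b] dimA ->]]]]|[[m A x0] -> dimA]].
  exists (ToricDatum A x0) => //; rewrite /datum_set /=; congr (_ @` _)%classic.
  apply/seteqP; split=> x /=; rewrite /affine_subspace /= mem_direction
      mulmxBr subr_eq0 x0b.
    by move=> ->.
  by move=> /eqP.
exists m, A, (map_mx ratr A *m x0); split=> //; first by exists x0.
congr (_ @` _)%classic; apply/seteqP; split=> x /=;
  rewrite /affine_subspace /= mem_direction mulmxBr subr_eq0.
  by move=> /eqP.
by move=> ->.
Qed.

(** Modulo integral vectors, each point of [datum_set t] differs from the common point [p] by a
    vector of [datum_dir t]. *)
Lemma datum_sub t u (p : torus R n) : datum_set t p -> datum_set u p ->
  (datum_dir t <= datum_dir u)%VS -> (datum_set t `<=` datum_set u)%classic.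
Proof.
have [x ->] := torus_proj_surj p.
move=> /datum_setP[z zint xt] /datum_setP[w wint xu] tu q.
have [y ->] := torus_proj_surj q => /datum_setP[z' z'int yt].
apply/datum_setP; exists (z' - z + w).
  by rewrite int_mxD // int_mxB.
have -> : y - (z' - z + w) - datum_pt u =
    (x - w - datum_pt u) + ((y - z' - datum_pt t) - (x - z - datum_pt t)).
  by apply/matrixP => i j; rewrite !mxE; ring.
by rewrite memvD // (subvP tu) // memvB.
Qed.

(* A direction in [datum_dir t] along which some integral equation of each [u]
   in [l] with [~ datum_dir t <= datum_dir u] is not constant meets the
   translates by Z^n of [u] in a discrete set of parameters only. *)
Lemma generic_point t (l : seq (toric_datum R n)) :
  exists2 p, datum_set t p & forall u, u \in l -> datum_set u p ->
    (datum_dir t <= datum_dir u)%VS.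
Proof.
have form u : exists f : 'rV[R]_n, ~~ (datum_dir t <= datum_dir u)%VS ->
  [/\ f \is a mxOver Num.int, forall x, x \in datum_dir u -> (f *m x) 0 0 = 0
    & exists2 x, x \in datum_dir t & (f *m x) 0 0 != 0].
  have [_|] := boolP (datum_dir t <= datum_dir u)%VS; first by exists 0.
  move=> /subvPn[x xt xu]; rewrite mem_direction in xu.
  have [N N_gt0 Nint] := common_denominator (datum_mx u).
  have [i [j Ax]] : exists i j, (map_mx ratr (datum_mx u) *m x) i j != 0.
    apply: contrapT => h; move/negP: xu; apply; apply/eqP/matrixP => i j.
    rewrite [RHS]mxE; apply: contrapT => /eqP Ax; apply: h.
    by exists i, j.
  have rowE y : (row i (map_mx ratr (datum_mx u) *+ N) *m y) 0 0 =
      (map_mx ratr (datum_mx u) *m y) i 0 *+ N.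
    by rewrite -row_mul -scaler_nat -scalemxAl !mxE mulr_natl.
  (* A row, with denominators cleared, that does not vanish at [x]. *)
  exists (row i (map_mx ratr (datum_mx u) *+ N)) => _; split.
  - apply/mxOverP => i' j'; rewrite mxE mulmxnE mxE -rmorphMn /=.
    have /mxOverP/(_ i j') := Nint; rewrite mulmxnE => /intrP[k ->].
    by rewrite ratr_int rpred_int.
  - by move=> y; rewrite mem_direction rowE => /eqP ->; rewrite mxE mul0rn.
  - by exists x => //; rewrite rowE mulrn_eq0 negb_or -lt0n N_gt0 /= -(ord1 j).
have [f fP] := choice form.
pose l' := [seq u <- l | ~~ (datum_dir t <= datum_dir u)%VS].
have [|d dt hd] := @exists_direction R n (datum_dir t) (map f l').
  by move=> _ /mapP[u ul ->]; move: ul; rewrite mem_filter => /andP[/fP[]].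
have [s _ hs] := @interval_avoid_int R
  [seq ((f u *m d) 0 0, (f u *m (datum_pt t - datum_pt u)) 0 0) | u <- l']
  0 1 ltr01.
exists (torus_proj (s *: d + datum_pt t)).
  apply/datum_setP; exists 0; first by rewrite mxOver0 ?rpred0.
  by rewrite subr0 addrK memvZ.
move=> u ul /datum_setP[z zint zu]; apply/negPn/negP => ntu.
have ul' : u \in l' by rewrite mem_filter ntu.
have [fint fu _] := fP u ntu.
have /hs/= : ((f u *m d) 0 0, (f u *m (datum_pt t - datum_pt u)) 0 0) \in
  [seq ((f u *m d) 0 0, (f u *m (datum_pt t - datum_pt u)) 0 0) | u <- l'].
  exact: (map_f (fun u => (_, _))).
rewrite hd ?map_f // => /(_ isT)/negP; apply.
(* The form [f u] vanishes on [datum_dir u] and is integral at [z], so its value at the parameter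
   [s] would be an integer. *)
have -> : (f u *m d) 0 0 * s + (f u *m (datum_pt t - datum_pt u)) 0 0 =
    (f u *m (s *: d + datum_pt t - z - datum_pt u)) 0 0 + (f u *m z) 0 0.
  rewrite !mulmxBr mulmxDr -scalemxAr !mxE; ring.
by rewrite fu // add0r (mxOverP (int_mxM fint zint)).
Qed.

End ToricData.

(** * Finiteness of intersections *)

Section ToricIntersections.
Variables (R : realType) (n : nat).
Implicit Types (t u : toric_datum R n) (x y : 'cV[R]_n).

Lemma direction_col_mx (m1 m2 : nat) (A : 'M[rat]_(m1, n)) (B : 'M[rat]_(m2, n))
    (x : 'cV[R]_n) :
  (x \in direction R (col_mx A B)) =
  (x \in direction R A) && (x \in direction R B).
Proof. by rewrite !mem_direction map_col_mx mul_col_mx col_mx_eq0. Qed.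

(** A vector of the sum of two rational subspaces splits by a rational linear map; clearing its
    denominators gives [Q]. *)
Lemma integral_splitting (m1 m2 : nat) (A : 'M[rat]_(m1, n))
    (B : 'M[rat]_(m2, n)) :
  exists (N : nat) (Q : 'M[R]_n), Q \is a mxOver Num.int /\
    forall x, x \in (direction R A + direction R B)%VS ->
      Q *m x \in direction R A /\ x *+ N.+1 - Q *m x \in direction R B.
Proof.
(* The component [y] of [x] in [direction R A] solves A y = 0, B y = B x, that is, C y = E x. As
   [pinvmx] solves systems in row vectors, [P] is built from transposes. *)
pose C := col_mx A B; pose E := col_mx 0 B : 'M_(m1 + m2, n).
pose P := (E^T *m pinvmx C^T)^T.
have [[//|N] _ Nint] := common_denominator P.
have CP (x y : 'cV[R]_n) : map_mx ratr C *m y = map_mx ratr E *m x ->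
    map_mx ratr C *m (map_mx ratr P *m x) = map_mx ratr E *m x.
  move=> Cy; apply: trmx_inj.
  have PT : (map_mx ratr P)^T =
      (map_mx ratr E)^T *m pinvmx (map_mx ratr C)^T :> 'M[R]_(n, _).
    by rewrite /P map_trmx trmxK map_mxM map_pinvmx -!map_trmx.
  rewrite !trmx_mul PT (mulmxA x^T).
  rewrite mulmxKpV // -trmx_mul -Cy trmx_mul; exact: submxMl.
exists N, (map_mx ratr (P *+ N.+1)); split.
  apply/mxOverP => i j; rewrite mxE.
  by have /mxOverP/(_ i j)/intrP[k ->] := Nint; rewrite ratr_int rpred_int.
move=> x /memv_addP[y yA [z zB xyz]].
have := CP x y; rewrite !map_col_mx !mul_col_mx map_mx0 mul0mx.
rewrite !mem_direction in yA zB *.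
rewrite (eqP yA) [in map_mx ratr B *m x]xyz mulmxDr (eqP zB) addr0.
move=> /(_ erefl)/eq_col_mx[AP BP].
have -> : map_mx ratr (P *+ N.+1) = map_mx ratr P *+ N.+1 :> 'M[R]_n.
  by rewrite raddfMn.
rewrite -scaler_nat -scalemxAl -scalemxAr AP scaler0 eqxx; split=> //.
rewrite -scaler_nat -scalerBr -scalemxAr mulmxBr BP xyz mulmxDr (eqP zB).
by rewrite addr0 subrr scaler0.
Qed.

(** Entries in ['I_N] make the residue vectors a finite type, which can be enumerated. *)
Definition ord_vec (N : nat) (r : 'cV['I_N]_n) : 'cV[R]_n :=
  map_mx (fun i : 'I_N => (i : nat)%:R) r.

Lemma residue_mod (N : nat) (w : 'cV[R]_n) : w \is a mxOver Num.int ->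
  exists (r : 'cV['I_N.+1]_n) (q : 'cV[R]_n), q \is a mxOver Num.int /\
    w = ord_vec r + q *+ N.+1.
Proof.
move=> /mxOverP wint.
exists (map_mx (fun a : R => inord `|(Num.floor a %% N.+1)%Z|%N) w).
exists (map_mx (fun a : R => (Num.floor a %/ N.+1)%Z%:~R) w); split.
  by apply/mxOverP => i j; rewrite mxE rpred_int.
apply/matrixP => i j; rewrite /ord_vec.
have := wint i j; rewrite intrEfloor => /eqP fl.
rewrite !mxE mulmxnE mxE -{1}fl; set k := Num.floor _.
have k_ge0 : (0 <= k %% N.+1)%Z by rewrite modz_ge0.
rewrite inordK; last by rewrite -ltz_nat gez0_abs // ltz_pmod.
rewrite natr_absz ger0_norm // {1}(divz_eq k N.+1) rmorphD rmorphM /=.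
by rewrite addrC mulr_natr.
Qed.

(* The intersection is the union, over integral w, of the images of the
   solution sets of x - pt t \in dir t, x - w - pt u \in dir u. These are cosets
   of one subtorus, and [integral_splitting] shows that those for which w has a
   given residue mod N.+1 coincide when nonempty: hence finiteness. *)
Lemma datum_setI t u : exists s : seq 'cV[R]_n,
  (datum_set t `&` datum_set u = [set p | exists2 x, x \in s &
    datum_set (ToricDatum (col_mx (datum_mx t) (datum_mx u)) x) p])%classic.
Proof.
pose D x := ToricDatum (col_mx (datum_mx t) (datum_mx u)) x.
have [N [Q [Qint QP]]] := integral_splitting (datum_mx t) (datum_mx u).
pose X (r : 'cV['I_N.+1]_n) x := exists q : 'cV[R]_n,
  let w := ord_vec r + q *+ N.+1 in
  [/\ q \is a mxOver Num.int, x - datum_pt t \in datum_dir t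
    & x - w - datum_pt u \in datum_dir u].
have D_pt x : datum_set (D x) (torus_proj x).
  apply/datum_setP; exists 0; first by rewrite mxOver0 ?rpred0.
  by rewrite subr0 subrr mem0v.
have XD r x y : X r x -> X r y ->
    (datum_set (D x) `<=` datum_set (D y))%classic.
  move=> [q [qint xt xu]] [q' [q'int yt yu]].
  refine (@datum_sub R n (D x) (D y) _ (D_pt x) _ (subvv _)); apply/datum_setP.
  set w := ord_vec r + _ in xu; set w' := ord_vec r + _ in yu.
  have ww : w' - w = (q' - q) *+ N.+1.
    by rewrite mulrnBl opprD addrACA subrr add0r.
  clearbody w w'.
  have qq : q' - q \in (datum_dir t + datum_dir u)%VS.
    suff : w' - w \in (datum_dir t + datum_dir u)%VS.
      by rewrite ww -scaler_nat rpredZeq pnatr_eq0.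
    have -> : w' - w = ((y - datum_pt t) - (x - datum_pt t)) +
         ((x - w - datum_pt u) - (y - w' - datum_pt u)).
      by apply/matrixP => i j; rewrite !mxE; ring.
    by apply: memv_add; apply: memvB.
  have [Qt Qu] := QP _ qq; rewrite -ww in Qu.
  (* [Q] splits [w' - w] into an integral vector of [datum_dir t] and a vector of [datum_dir u];
     adding the former to [x - y] brings it into both directions. *)
  exists (- (Q *m (q' - q))); first by rewrite int_mxN int_mxM // int_mxB.
  move: (Q *m _) Qt Qu => v vt vu.
  rewrite opprK direction_col_mx; apply/andP; split.
    have -> : x + v - y = (x - datum_pt t) - (y - datum_pt t) + v.
      by apply/matrixP => i j; rewrite !mxE; ring.
    by rewrite memvD // memvB.
  have -> : x + v - y = (x - w - datum_pt u) - (y - w' - datum_pt u)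
      - (w' - w - v).
    by apply/matrixP => i j; rewrite !mxE; ring.
  by rewrite memvB // memvB.
(* One base point for each residue that occurs; the filter keeps the default [0] from being used. *)
exists [seq xget 0 (X r) | r <- enum 'cV['I_N.+1]_n & `[< exists x, X r x >]].
apply/seteqP; split=> p /=.
  have [x ->] := torus_proj_surj p.
  move=> [[y yt /torus_proj_eq yx] /datum_setP[z zint xu]].
  have [|r [q [qint zq]]] := @residue_mod N (z + (y - x)).
    by rewrite int_mxD.
  have Xy : X r y.
    exists q; rewrite -zq /=; split=> //.
    rewrite (_ : y - (z + (y - x)) = x - z) //.
    by apply/matrixP => i j; rewrite !mxE; ring.
  exists (xget 0 (X r)).
    by apply: map_f; rewrite mem_filter mem_enum andbT; apply/asboolP; exists y.
  apply: (XD r y) => //; first by apply: (xgetPex 0 (P := X r)); exists y.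
  by rewrite -(torus_proj_eq y x).2.
move=> [y /mapP[r]]; rewrite mem_filter => /andP[/asboolP/(xgetPex 0)].
move=> [q [qint yt yu]] _ ->; move: (xget 0 (X r)) yt yu => {}y yt yu.
have [x ->] := torus_proj_surj p.
move=> /datum_setP[z zint]; rewrite direction_col_mx => /andP[/= xt xu].
split; apply/datum_setP.
  exists z => //.
  have -> : x - z - datum_pt t = (x - z - y) + (y - datum_pt t).
    by apply/matrixP => i j; rewrite !mxE; ring.
  by rewrite memvD.
exists (z + (ord_vec r + q *+ N.+1)).
  rewrite !int_mxD //; apply/mxOverP => i j; first by rewrite mxE rpred_nat.
  by rewrite mulmxnE rpredMn // (mxOverP qint).
set w := ord_vec r + _ in yu *.
have -> : x - (z + w) - datum_pt u = (x - z - y) + (y - w - datum_pt u).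
  by apply/matrixP => i j; rewrite !mxE; ring.
by rewrite memvD.
Qed.

End ToricIntersections.

(** * Combinations of indicators and their dimension polynomials *)

Section Valuation.
Variables (R : realType) (n : nat).
Implicit Types (t u : toric_datum R n) (f g : torus R n -> int).

Definition indicator (A : set (torus R n)) : torus R n -> int :=
  fun p => `[< A p >]%:R.

Definition combination (l : seq (int * toric_datum R n)) : torus R n -> int :=
  fun p => \sum_(c <- l) c.1 * indicator (datum_set c.2) p.

(** The linear extension, computed from a list; [eq_dim_poly] shows that it depends only on the
    function represented. *)
Definition dim_poly (l : seq (int * toric_datum R n)) : {poly int} :=
  \sum_(c <- l) c.1 *: 'X^(\dim (datum_dir c.2)).

Definition representable f := exists l, f = combination l.

Lemma exists_max (T : eqType) (h : T -> nat) (l : seq T) : l != [::] ->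
  exists2 x, x \in l & forall y, y \in l -> (h y <= h x)%N.
Proof.
elim: l => // a [|b l] IH _.
  by exists a; rewrite ?inE // => y; rewrite inE => /eqP ->.
have [//|x xl hx] := IH; have [le_ax|lt_xa] := leqP (h a) (h x).
  exists x; first by rewrite inE xl orbT.
  by move=> y; rewrite inE => /predU1P[->|/hx].
exists a; first exact: mem_head.
move=> y; rewrite inE => /predU1P[->//|/hx yx].
by rewrite ltnW ?(leq_ltn_trans yx).
Qed.

Lemma dim_poly_eq0 l : (forall p, combination l p = 0) -> dim_poly l = 0.
Proof.
have [k] := ubnP (size l); elim: k l => // k IH l lt_lk l0.
have [->|l_neq0] := eqVneq l [::]; first by rewrite /dim_poly big_nil.
have [[c0 t] tl tmax] :=
  exists_max (fun c : int * toric_datum R n => \dim (datum_dir c.2)) l_neq0.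
have [p tp pgen] := generic_point t (map snd l).
pose J (c : int * toric_datum R n) := `[< datum_set c.2 p >].
(* Genericity of [p] gives an inclusion of directions, maximality of the dimension makes it an
   equality, and the common point [p] then identifies the sets. *)
have JP c : c \in l -> J c -> datum_set c.2 = datum_set t /\
    \dim (datum_dir c.2) = \dim (datum_dir t).
  move=> cl /asboolP cp; have tc := pgen c.2 (map_f snd cl) cp.
  have dimE : \dim (datum_dir c.2) = \dim (datum_dir t).
    by apply/eqP; rewrite eqn_leq tmax //= dimvS.
  have dirE : datum_dir t = datum_dir c.2.
    by apply/eqP; rewrite eqEdim tc dimE /=.
  split=> //; apply/seteqP; split.
    by apply: (@datum_sub R n c.2 t p) => //; rewrite dirE.
  by apply: (@datum_sub R n t c.2 p).
have sumJ : \sum_(c <- l | J c) c.1 = 0.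
  rewrite -[RHS](l0 p) /combination [RHS](bigID J) /=.
  rewrite [X in _ = _ + X]big1 => [|c].
    rewrite addr0; apply: eq_bigr => c Jc.
    by rewrite /indicator (_ : `[< _ >] = true) ?mulr1.
  by rewrite /indicator -/(J c) => /negbTE ->; rewrite mulr0.
rewrite /dim_poly (bigID J) /= -[X in _ + X]big_filter.
rewrite -/(dim_poly [seq c <- l | ~~ J c]) IH ?addr0.
- rewrite big_seq_cond.
  rewrite (eq_bigr (fun c => c.1 *: 'X^(\dim (datum_dir t)))).
    by rewrite -big_seq_cond -scaler_suml sumJ scale0r.
  by move=> c /andP[cl Jc]; rewrite (JP c cl Jc).2.
- rewrite -ltnS (leq_trans _ lt_lk) // ltnS size_filter -(count_predC J l).
  rewrite -addn1 addnC leq_add2r -has_count.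
  by apply/hasP; exists (c0, t) => //; apply/asboolP.
- move=> q; rewrite -[RHS](l0 q) /combination big_filter [RHS](bigID J) /=.
  rewrite [X in _ = X + _]big_seq_cond.
  rewrite [X in _ = X + _](eq_bigr (fun c => c.1 * indicator (datum_set t) q)).
    by rewrite -big_seq_cond -mulr_suml sumJ mul0r add0r.
  by move=> c /andP[cl Jc]; rewrite (JP c cl Jc).1.
Qed.

Lemma combination_cat l1 l2 p :
  combination (l1 ++ l2) p = combination l1 p + combination l2 p.
Proof. exact: big_cat. Qed.

Lemma dim_poly_cat l1 l2 : dim_poly (l1 ++ l2) = dim_poly l1 + dim_poly l2.
Proof. exact: big_cat. Qed.

Definition scale_coefs (a : int) (l : seq (int * toric_datum R n)) :=
  [seq (a * c.1 : int, c.2) | c <- l].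

Lemma combination_scale a l p :
  combination (scale_coefs a l) p = a * combination l p.
Proof.
by rewrite /combination big_map mulr_sumr; apply: eq_bigr => c _; rewrite mulrA.
Qed.

Lemma dim_poly_scale a l : dim_poly (scale_coefs a l) = a *: dim_poly l.
Proof.
rewrite /dim_poly big_map scaler_sumr.
by apply: eq_bigr => c _; rewrite scalerA.
Qed.

(** Linear independence, applied to the difference of the combinations. *)
Lemma eq_dim_poly l1 l2 : combination l1 =1 combination l2 ->
  dim_poly l1 = dim_poly l2.
Proof.
move=> l12; apply/eqP; rewrite -subr_eq0 -scaleN1r -dim_poly_scale.
rewrite -dim_poly_cat.
apply/eqP/dim_poly_eq0 => p.
by rewrite combination_cat combination_scale l12 mulN1r subrr.
Qed.

(** * Closure properties of the span of indicators *)

Lemma representable0 : representable (fun=> 0).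
Proof. by exists [::]; apply/funext => p; rewrite /combination big_nil. Qed.

Lemma representableD f g :
  representable f -> representable g -> representable (fun p => f p + g p).
Proof.
move=> [l ->] [l' ->]; exists (l ++ l').
by apply/funext => p; rewrite combination_cat.
Qed.

Lemma representableZ a f : representable f -> representable (fun p => a * f p).
Proof.
move=> [l ->]; exists (scale_coefs a l); apply/funext => p.
by rewrite combination_scale.
Qed.

Lemma representable_sum (I : Type) (l : seq I) (F : I -> torus R n -> int) :
  (forall i, representable (F i)) ->
  representable (fun p => \sum_(i <- l) F i p).
Proof.
move=> hF; elim: l => [|i l IH].
  by under eq_fun do rewrite big_nil; exact: representable0.
by under eq_fun do rewrite big_cons; exact: representableD.
Qed.

Lemma combination1 t : combination [:: (1, t)] = indicator (datum_set t).
Proof. by apply/funext => p; rewrite /combination big_seq1 mul1r. Qed.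

Lemma representable_datum t : representable (indicator (datum_set t)).
Proof. by exists [:: (1, t)]; rewrite combination1. Qed.

(* Toric subspaces with the same equations are cosets of one subgroup, hence
   equal or disjoint. *)
Lemma representable_cosets (m : nat) (C : 'M[rat]_(m, n)) (s : seq 'cV[R]_n) :
  representable (indicator
    [set p | exists2 x, x \in s & datum_set (ToricDatum C x) p]%classic).
Proof.
elim: s => [|x s IH].
  rewrite (_ : indicator _ = fun=> 0); first exact: representable0.
  by apply/funext => p; rewrite /indicator asboolF // => -[].
(* A new coset that meets an earlier one lies in it and leaves the union unchanged; otherwise the
   union is disjoint and indicators add. *)
have [[q [qx [y ys qy]]]|disj] := pselect (exists q,
    datum_set (ToricDatum C x) q /\
    exists2 y, y \in s & datum_set (ToricDatum C y) q).
  rewrite (_ : mkset _ =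
    [set p | exists2 x, x \in s & datum_set (ToricDatum C x) p]%classic) //.
  apply/seteqP; split=> p /= [z zs pz]; last first.
    by exists z; rewrite // inE zs orbT.
  move: zs; rewrite inE => /predU1P[zx|zs]; last by exists z.
  exists y => //; rewrite zx in pz.
  exact: (@datum_sub R n (ToricDatum C x) (ToricDatum C y) q qx qy (subvv _)).
have := representableD (representable_datum (ToricDatum C x)) IH.
congr representable; apply/funext => p.
rewrite /indicator; case: asboolP => /= [px|npx].
  rewrite asboolF => [|[y ys py]].
    by rewrite asboolT ?addr0 //; exists x; rewrite ?mem_head.
  by apply: disj; exists p; split=> //; exists y.
rewrite add0r; congr (_%:R); congr nat_of_bool; apply/asbool_equiv_eq.
split=> [[y ys py]|[y]]; first by exists y; rewrite // inE ys orbT.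
by rewrite inE => /predU1P[->//|ys py]; exists y.
Qed.

Lemma indicatorI (A B : set (torus R n)) p :
  indicator (A `&` B)%classic p = indicator A p * indicator B p.
Proof. by rewrite /indicator asbool_and -natrM mulnb. Qed.

Lemma indicatorC (A : set (torus R n)) p :
  indicator (~` A)%classic p = 1 - indicator A p.
Proof. by rewrite /indicator asbool_neg; case: asbool. Qed.

Lemma indicatorUI (A B : set (torus R n)) p :
  indicator (A `&` B)%classic p + indicator (A `|` B)%classic p =
  indicator A p + indicator B p.
Proof. by rewrite /indicator asbool_and asbool_or; do 2!case: asbool. Qed.

(** The product expands into indicators of pairwise intersections, each a finite union of cosets of
    one subtorus. *)
Lemma representableM f g :
  representable f -> representable g -> representable (fun p => f p * g p).
Proof.
move=> [l ->] [l' ->].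
rewrite (_ : (fun p => _) = fun p => \sum_(c <- l) \sum_(c' <- l')
    (c.1 * c'.1) * indicator (datum_set c.2 `&` datum_set c'.2)%classic p).
  apply: representable_sum => c; apply: representable_sum => c'.
  apply: representableZ; have [s ->] := datum_setI c.2 c'.2.
  exact: representable_cosets.
apply/funext => p; rewrite /combination mulr_suml; apply: eq_bigr => c _.
by rewrite mulr_sumr; apply: eq_bigr => c' _; rewrite indicatorI mulrACA.
Qed.

Lemma datum_setT :
  datum_set (@ToricDatum R n 0 0 0) = [set: torus R n]%classic.
Proof.
apply/seteqP; split=> // p _; have [x ->] := torus_proj_surj p.
apply/datum_setP; exists 0; first by rewrite mxOver0 ?rpred0.
by rewrite mem_direction; apply/eqP/matrixP => -[].
Qed.

(** The empty system defines the whole torus; its indicator is needed for complements. *)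
Lemma representableT : representable (fun=> 1).
Proof.
have := representable_datum (@ToricDatum R n 0 0 0).
rewrite datum_setT; congr representable.
by apply/funext => p; rewrite /indicator asboolT.
Qed.

(** Minimality of the lattice: products handle intersections, [1 - f] handles complements, and
    unions follow by De Morgan. *)
Lemma representable_lattice (A : set (torus R n)) :
  toric_lattice A -> representable (indicator A).
Proof.
have repI (B C : set (torus R n)) : representable (indicator B) ->
    representable (indicator C) -> representable (indicator (B `&` C)%classic).
  by move=> hB hC; rewrite (funext (indicatorI B C)); exact: representableM.
have repC (B : set (torus R n)) : representable (indicator B) ->
    representable (indicator (~` B)%classic).
  move=> hB; rewrite (funext (indicatorC B)).
  have := representableD representableT (representableZ (-1) hB).
  by under eq_fun do rewrite mulN1r.
apply: (smallest_sub (X := [set B | representable (indicator B)]%classic)).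
  split=> [B C|B C hB hC|B]; [exact: repI| |exact: repC].
  by rewrite /= -[(_ `|` _)%classic]setCK setCU; apply/repC/repI; exact: repC.
move=> _ [q [W [hW ->]]] /=.
have -> : [set: 'I_q.+1]%classic = [set` enum 'I_q.+1]%classic.
  by apply/seteqP; split=> i // _ /=; rewrite mem_enum.
rewrite bigcap_seq; apply: (big_ind (fun B => representable (indicator B))).
- rewrite (_ : indicator _ = fun=> 1); first exact: representableT.
  by apply/funext => p; rewrite /indicator asboolT.
- exact: repI.
- move=> i _; have [k /toric_subspace_of_dimP[t -> _]] := hW i.
  exact: representable_datum.
Qed.

(** * The valuation *)

(** A representing list is chosen; the default [[::]] gives the value 0 where none exists. *)
Definition toric_valuation (A : set (torus R n)) : {poly int} :=
  dim_poly (xget [::] [set l | indicator A = combination l]%classic).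

Lemma toric_valuationE (A : set (torus R n)) l :
  indicator A = combination l -> toric_valuation A = dim_poly l.
Proof.
move=> Al; apply: eq_dim_poly => p.
have /= lA := @xgetPex _ [::] [set l | indicator A = combination l]%classic
  (ex_intro _ l Al).
by rewrite -lA Al.
Qed.

End Valuation.

Theorem theorem1p15 (R : realType) (n : nat) :
  exists v : set (torus R n) -> {poly int},
    is_valuation (@toric_lattice R n) v /\
    forall (k : nat) (V : set (torus R n)),
      toric_subspace_of_dim k V -> v V = 'X^k.
Proof.
exists (@toric_valuation R n); split=> [|k V /toric_subspace_of_dimP[t -> <-]].
  split.
    rewrite (toric_valuationE (l := [::])) ?/dim_poly ?big_nil //.
    by apply/funext => p; rewrite /combination big_nil /indicator asboolF.
  move=> A B LA LB.
  have LI : toric_lattice (A `&` B)%classic.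
    by move=> M hM; have [[MI _ _] _] := hM; apply: MI; [exact: LA|exact: LB].
  have LU : toric_lattice (A `|` B)%classic.
    by move=> M hM; have [[_ MU _] _] := hM; apply: MU; [exact: LA|exact: LB].
  have [a Aa] := representable_lattice LA.
  have [b Bb] := representable_lattice LB.
  have [c Cc] := representable_lattice LI.
  have [d Dd] := representable_lattice LU.
  (* Concatenated lists represent sums, so both sides come from the two sides of [indicatorUI]. *)
  rewrite (toric_valuationE Aa) (toric_valuationE Bb) (toric_valuationE Cc).
  rewrite (toric_valuationE Dd) -!dim_poly_cat; apply: eq_dim_poly => p.
  by rewrite !combination_cat -Aa -Bb -Cc -Dd indicatorUI.
rewrite (toric_valuationE (l := [:: (1, t)])) ?combination1 //.
by rewrite /dim_poly big_seq1 scale1r.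
Qed.
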